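(* The following hold: (i) $\mathcal J_{\mathrm{svi}}$ is monotonic: for all $X,Y\subseteq\mathrm{SENT}$, $X\subseteq Y$ implies $\mathcal J_{\mathrm{svi}}(X)\subseteq\mathcal J_{\mathrm{svi}}(Y)$. Therefore there are fixed points of $\mathcal J_{\mathrm{svi}}$. (ii) For every structure $\mathcal M$ and world $w\in W_{\mathcal M}$ there exists a structure $\mathcal M'$ satisfying the admissibility requirement, i.e. such that $\mathcal I_{\mathcal M}\leqq_f\mathcal I_{\mathcal M'}$ for some $f$. Therefore there are non-degenerate fixed points of $\mathcal J_{\mathrm{svi}}$, i.e. sets $X=\mathcal J_{\mathrm{svi}}(X)$ with $X\neq\mathrm{SENT}$.
   Context: **Language.** $\mathcal L_{\mathbb N}$ is the language of Heyting arithmetic (logical symbols $\bot,\to,\vee,\wedge,\forall,\exists$; $\neg A$ is $A\to\bot$), with finitely many additional function symbols for primitive recursive functions. $\mathcal L_{\mathrm{Tr}}=\mathcal L_{\mathbb N}\cup\{\mathrm{Tr}\}$ with $\mathrm{Tr}$ a unary predicate. Fix a standard Gödel numbering; $\#\varphi$ is the code of $\varphi$, $\bar n$ the numeral of $n$, $t^{\mathbb N}$ the value of a closed term $t$ in the standard model. $\mathrm{SENT}\subseteq\omega$ is the set of codes of sentences of $\mathcal L_{\mathrm{Tr}}$. **Structures.** A *structure* (persistent first-order intuitionistic Kripke $\omega$-structure) is $\mathcal M=\langle W_{\mathcal M},\le_{\mathcal M},\mathcal D_{\mathcal M},\mathcal I_{\mathcal M}\rangle$ with $W_{\mathcal M}$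 a set (of worlds), $\le_{\mathcal M}$ a partial order on it, $\mathcal D_{\mathcal M}$ assigning the domain $\omega$ to each world, and $\mathcal I_{\mathcal M}\subseteq W_{\mathcal M}\times\mathrm{SENT}$ such that $u\le_{\mathcal M}v$ and $\langle u,x\rangle\in\mathcal I_{\mathcal M}$ imply $\langle v,x\rangle\in\mathcal I_{\mathcal M}$. Write $\mathcal I_{\mathcal M}(w)=\{x:\langle w,x\rangle\in\mathcal I_{\mathcal M}\}$. **Forcing** $w\Vdash_{\mathcal M}A$ for sentences $A$ of $\mathcal L_{\mathrm{Tr}}$: $w\nVdash\bot$; an atomic arithmetical sentence is forced iff true in $\mathbb N$; $w\Vdash\mathrm{Tr}(s)$ iff $s^{\mathbb N}\in\mathcal I_{\mathcal M}(w)$; $\wedge,\vee$ are evaluated at $w$ in the usual way; $w\Vdash A\to B$ iff for all $w'\ge w$, $w'\Vdash A$ implies $w'\Vdash B$; $w\Vdash\exists xA$ iff $w\Vdash A(\bar n)$ for some $n\in\omega$; $w\Vdash\forall xA$ iff $w'\Vdash A(\bar n)$ for all $w'\ge w$ and all $n\in\omega$. **Embeddings.** $f:W_{\mathcal M}\to W_{\mathcal M'}$ is an embedding-interpretation function, written $\mathcal I_{\mathcal M}\leqq_f\mathcal I_{\mathcal M'}$, iff $f$ is injective, $w_0\le_{\mathcal M}w_1\Leftrightarrow f(w_0)\le_{\mathcal M'}f(w_1)$, and $\mathcal I_{\mathcal M}(w)\subseteq\mathcal I_{\mathcal M'}(f(w))$ for all $w$. **Supervaluation.** $w\Vdash^{\mathcal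 M}_{\mathrm{svi}}\varphi$ iff for all structures $\mathcal M'$ and all $f$ with $\mathcal I_{\mathcal M}\leqq_f\mathcal I_{\mathcal M'}$, $f(w)\Vdash_{\mathcal M'}\varphi$. For $X\subseteq\mathrm{SENT}$: $\mathcal J_{\mathrm{svi}}(X)=\{\#\varphi\in\mathrm{SENT} : \forall\mathcal M\,\forall w\in W_{\mathcal M}(\mathcal I_{\mathcal M}(w)=X\Rightarrow w\Vdash^{\mathcal M}_{\mathrm{svi}}\varphi)\}$. *)

(* Defs.v *)
From mathcomp Require Import all_boot.
From mathcomp Require Export boolp classical_sets.
From Stdlib Require Import Relation_Definitions.

Set Implicit Arguments.
Unset Strict Implicit.
Unset Printing Implicit Defensive.

Local Open Scope classical_set_scope.

Definition vcons (T : Type) k (x : T) (v : 'I_k -> T) : 'I_k.+1 -> T :=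
  fun i => if unlift ord0 i is Some j then v j else x.

(* [PRcomp] with m = 0 lifts [PRzero] to the constant 0 of any arity; [PRrec]
   recurses on the first argument. *)
Inductive primrec : nat -> Type :=
| PRzero : primrec 0
| PRsucc : primrec 1
| PRproj k (i : 'I_k) : primrec k
| PRcomp k m (g : primrec m) (h : 'I_m -> primrec k) : primrec k
| PRrec k (g : primrec k) (h : primrec k.+2) : primrec k.+1.

Fixpoint primrec_eval k (p : primrec k) : ('I_k -> nat) -> nat :=
  match p with
  | PRzero => fun _ => 0
  | PRsucc => fun v => (v ord0).+1
  | PRproj _ i => fun v => v i
  | PRcomp _ _ g h => fun v => primrec_eval g (fun i => primrec_eval (h i) v)
  | PRrec _ g h => fun v =>
      let tl := fun i => v (lift ord0 i) in
      iteri (v ord0) (fun n r => primrec_eval h (vcons n (vcons r tl)))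
        (primrec_eval g tl)
  end.

(* The finitely many function symbols added to 0, S, +, * : each comes with its
   arity and a definition of the primitive recursive function it denotes. *)
Record pr_signature := PrSignature {
  pr_num : nat;
  pr_arity : 'I_pr_num -> nat;
  pr_def : forall i : 'I_pr_num, primrec (pr_arity i) }.

Section Syntax.
Variable L : pr_signature.

Inductive term :=
| Var (x : nat)
| Zero
| Succ (t : term)
| Add (s t : term)
| Mul (s t : term)
| App (i : 'I_(pr_num L)) (a : 'I_(pr_arity i) -> term).

Inductive formula :=
| Bot
| Eq (s t : term)
| Tr (s : term)
| Imp (A B : formula)
| And (A B : formula)
| Or (A B : formula)
| All (x : nat) (A : formula)
| Ex (x : nat) (A : formula).

Definition Neg A := Imp A Bot.

Definition numeral (n : nat) : term := iter n Succ Zero.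

Fixpoint term_free (x : nat) (t : term) : bool :=
  match t with
  | Var y => x == y
  | Zero => false
  | Succ t => term_free x t
  | Add s t | Mul s t => term_free x s || term_free x t
  | App i a => [exists j, term_free x (a j)]
  end.

Fixpoint free (x : nat) (A : formula) : bool :=
  match A with
  | Bot => false
  | Eq s t => term_free x s || term_free x t
  | Tr s => term_free x s
  | Imp A B | And A B | Or A B => free x A || free x B
  | All y A | Ex y A => (x != y) && free x A
  end.

Definition sentence (A : formula) : Prop := forall x, ~~ free x A.

Fixpoint term_subst (x : nat) (u t : term) : term :=
  match t with
  | Var y => if x == y then u else Var y
  | Zero => Zero
  | Succ t => Succ (term_subst x u t)
  | Add s t => Add (term_subst x u s) (term_subst x u t)
  | Mul s t => Mul (term_subst x u s) (term_subst x u t)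
  | App i a => App (fun j => term_subst x u (a j))
  end.

(* Only used with u closed, so that no variable of u can be captured. *)
Fixpoint subst (x : nat) (u : term) (A : formula) : formula :=
  match A with
  | Bot => Bot
  | Eq s t => Eq (term_subst x u s) (term_subst x u t)
  | Tr s => Tr (term_subst x u s)
  | Imp A B => Imp (subst x u A) (subst x u B)
  | And A B => And (subst x u A) (subst x u B)
  | Or A B => Or (subst x u A) (subst x u B)
  | All y A => All y (if x == y then A else subst x u A)
  | Ex y A => Ex y (if x == y then A else subst x u A)
  end.

(* The value in the standard model; variables get the junk value 0, so this is
   meaningful for closed terms only. *)
Fixpoint value (t : term) : nat :=
  match t with
  | Var _ => 0
  | Zero => 0
  | Succ t => (value t).+1
  | Add s t => value s + value t
  | Mul s t => value s * value t
  | App i a => primrec_eval (pr_def i) (fun j => value (a j))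
  end.

(* [CodeSeq.code] is a bijection between finite sequences of numbers and
   numbers; the first entry is a tag, distinct for each constructor. *)
Fixpoint term_code (t : term) : nat :=
  match t with
  | Var x => CodeSeq.code [:: 0; x]
  | Zero => CodeSeq.code [:: 1]
  | Succ t => CodeSeq.code [:: 2; term_code t]
  | Add s t => CodeSeq.code [:: 3; term_code s; term_code t]
  | Mul s t => CodeSeq.code [:: 4; term_code s; term_code t]
  | App i a => CodeSeq.code
      [:: 5, val i & [seq term_code (a j) | j <- enum 'I_(pr_arity i)]]
  end.

Fixpoint code (A : formula) : nat :=
  match A with
  | Bot => CodeSeq.code [:: 6]
  | Eq s t => CodeSeq.code [:: 7; term_code s; term_code t]
  | Tr s => CodeSeq.code [:: 8; term_code s]
  | Imp A B => CodeSeq.code [:: 9; code A; code B]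
  | And A B => CodeSeq.code [:: 10; code A; code B]
  | Or A B => CodeSeq.code [:: 11; code A; code B]
  | All x A => CodeSeq.code [:: 12; x; code A]
  | Ex x A => CodeSeq.code [:: 13; x; code A]
  end.

Definition SENT : set nat := [set c | exists2 A, sentence A & c = code A].

Let codeI (s t : seq nat) : CodeSeq.code s = CodeSeq.code t -> s = t.
Proof. exact: can_inj CodeSeq.codeK s t. Qed.

Lemma term_code_inj : injective term_code.
Proof.
elim=> [x||t IH|s IHs t IHt|s IHs t IHt|i a IH] [y||t'|s' t'|s' t'|i' a'];
  move=> /codeI // [].
- by move=> ->.
- by move=> /IH->.
- by move=> /IHs-> /IHt->.
- by move=> /IHs-> /IHt->.
move=> /val_inj ei; case: i' / ei a' => a' /eq_in_map ea.
by congr App; apply: funext => j; apply: IH; apply: ea; rewrite mem_enum.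
Qed.

Lemma code_inj : injective code.
Proof.
elim=> [|s t|s|A IA B IB|A IA B IB|A IA B IB|x A IA|x A IA]
  [|s' t'|s'|A' B'|A' B'|A' B'|x' A'|x' A'] /codeI // [].
- by move=> /term_code_inj-> /term_code_inj->.
- by move=> /term_code_inj->.
- by move=> /IA-> /IB->.
- by move=> /IA-> /IB->.
- by move=> /IA-> /IB->.
- by move=> -> /IA->.
- by move=> -> /IA->.
Qed.

Fixpoint depth (A : formula) : nat :=
  match A with
  | Bot | Eq _ _ | Tr _ => 0
  | Imp A B | And A B | Or A B => (maxn (depth A) (depth B)).+1
  | All _ A | Ex _ A => (depth A).+1
  end.

Lemma depth_subst x u A : depth (subst x u A) = depth A.
Proof.
by elim: A => //= [A -> B ->|A -> B ->|A -> B ->|y A IH|y A IH] //;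
  case: eqP; rewrite ?IH.
Qed.

(* All worlds have domain omega, so domains are left implicit. *)
Record structure := Structure {
  world : Type;
  wle : relation world;
  wle_order : order world wle;
  interp : world -> set nat;
  interp_sent : forall w, interp w `<=` SENT;
  interp_persistent : forall u v, wle u v -> interp u `<=` interp v }.

(* Forcing is by recursion on the depth of a formula rather than on the formula
   itself, since the quantifier clauses substitute numerals; the clauses for
   [forces] are the lemmas [forces_bot] to [forces_ex] below. *)
Fixpoint forces_upto (M : structure) (d : nat) (w : world M) (A : formula)
    {struct d} : Prop :=
  match A, d with
  | Bot, _ => False
  | Eq s t, _ => value s = value t
  | Tr s, _ => interp w (value s)
  | Imp A B, d.+1 =>
      forall w', wle w w' -> forces_upto d w' A -> forces_upto d w' B
  | And A B, d.+1 => forces_upto d w A /\ forces_upto d w B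
  | Or A B, d.+1 => forces_upto d w A \/ forces_upto d w B
  | All x A, d.+1 =>
      forall w', wle w w' -> forall n, forces_upto d w' (subst x (numeral n) A)
  | Ex x A, d.+1 => exists n, forces_upto d w (subst x (numeral n) A)
  | _, 0 => False
  end.

Definition forces (M : structure) (w : world M) (A : formula) : Prop :=
  forces_upto (depth A) w A.

Lemma forces_uptoE (M : structure) d (w : world M) A :
  depth A <= d -> forces_upto d w A = forces w A.
Proof.
rewrite /forces => le_Ad; have := leqnn (depth A).
move: {2 3}(depth A) => e le_Ae.
elim: d e w A le_Ad le_Ae => [|d IH] [|e] w [|s t|s|A B|A B|A B|x A|x A] //=;
  rewrite ?ltnS ?geq_max.
- move=> /andP[? ?] /andP[? ?].
  by rewrite propeqE; split=> h w' le_ww'; move: (h w' le_ww');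
    rewrite !(IH e).
- by move=> /andP[? ?] /andP[? ?]; rewrite !(IH e).
- by move=> /andP[? ?] /andP[? ?]; rewrite !(IH e).
- move=> ? ?; rewrite propeqE; split=> h w' le_ww' n; move: (h w' le_ww' n);
    by rewrite (IH e) ?depth_subst.
- move=> ? ?; rewrite propeqE; split=> -[n h]; exists n; move: h;
    by rewrite (IH e) ?depth_subst.
Qed.

Section Clauses.
Variables (M : structure) (w : world M).

Lemma forces_bot : forces w Bot <-> False.
Proof. by []. Qed.

Lemma forces_eq s t : forces w (Eq s t) <-> value s = value t.
Proof. by []. Qed.

Lemma forces_tr s : forces w (Tr s) <-> interp w (value s).
Proof. by []. Qed.

Lemma forces_and A B : forces w (And A B) <-> forces w A /\ forces w B.
Proof. by rewrite {1}/forces /= !forces_uptoE ?leq_maxl ?leq_maxr. Qed.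

Lemma forces_or A B : forces w (Or A B) <-> forces w A \/ forces w B.
Proof. by rewrite {1}/forces /= !forces_uptoE ?leq_maxl ?leq_maxr. Qed.

Lemma forces_imp A B :
  forces w (Imp A B) <-> forall w', wle w w' -> forces w' A -> forces w' B.
Proof.
rewrite {1}/forces /=.
by split=> h w' le_ww'; move: (h w' le_ww');
  rewrite !forces_uptoE ?leq_maxl ?leq_maxr.
Qed.

Lemma forces_all x A :
  forces w (All x A) <->
  forall w', wle w w' -> forall n, forces w' (subst x (numeral n) A).
Proof.
rewrite {1}/forces /=.
by split=> h w' le_ww' n; move: (h w' le_ww' n);
  rewrite forces_uptoE ?depth_subst.
Qed.

Lemma forces_ex x A :
  forces w (Ex x A) <-> exists n, forces w (subst x (numeral n) A).
Proof.
rewrite {1}/forces /=.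
by split=> -[n h]; exists n; move: h; rewrite forces_uptoE ?depth_subst.
Qed.

End Clauses.

Definition embedding (M M' : structure) (f : world M -> world M') : Prop :=
  [/\ injective f,
      forall w0 w1, wle w0 w1 <-> wle (f w0) (f w1)
    & forall w, interp w `<=` interp (f w)].

Definition svi (M : structure) (w : world M) (A : formula) : Prop :=
  forall (M' : structure) (f : world M -> world M'),
    embedding f -> forces (f w) A.

Definition Jsvi (X : set nat) : set nat :=
  [set c | exists A, [/\ sentence A, c = code A &
    forall (M : structure) (w : world M), interp w = X -> svi w A]].

End Syntax.

(* Main.v *)
(** Monotonicity of [Jsvi]: if [w] is a world of [M] with interpretation
    [Y] and [X `<=` Y], then shrinking the interpretation of [M] to [X] above
    [w] and to the empty set elsewhere gives a structure whose embeddings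
    include all those of [M].  By Knaster-Tarski [Jsvi] then has a fixed point;
    no fixed point is degenerate, since every set of sentences is the
    interpretation of the world of a one-world structure, which embeds into
    itself and does not force [Bot]. *)

Require Import Defs.
From mathcomp Require Import all_boot.
From mathcomp Require Import boolp classical_sets.
From Stdlib Require Import Relation_Definitions.

Local Open Scope classical_set_scope.

(** Knaster-Tarski relative to [S]: the intersection of all pre-fixed subsets of [S] is fixed. *)
Lemma fixpoint_of_monotone (T : Type) (S : set T) (J : set T -> set T) :
  (forall X, J X `<=` S) ->
  (forall X Y, X `<=` S -> Y `<=` S -> X `<=` Y -> J X `<=` J Y) ->
  exists X, X `<=` S /\ J X = X.
Proof.
move=> JS Jmono.
pose X := \bigcap_(Z in [set Z | Z `<=` S /\ J Z `<=` Z]) Z.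
have X_lb Z : Z `<=` S -> J Z `<=` Z -> X `<=` Z by move=> ZS JZ x; apply.
have XS : X `<=` S by apply: X_lb.
have JX : J X `<=` X.
  by move=> x Jx Z [ZS JZ]; apply: (JZ); apply: (Jmono X Z) => //; exact: X_lb.
exists X; split=> //; rewrite eqEsubset; split=> //.
(* [J X] is itself pre-fixed, by monotonicity applied to [JX]. *)
by apply: X_lb; [exact: JS | exact: Jmono].
Qed.

Section Supervaluation.
Variable L : pr_signature.
Implicit Types (M : structure L) (X Y : set nat).

Lemma embedding_id M : embedding (id : world M -> world M).
Proof. by split=> [x y | u v | v x]. Qed.

Section UpsetStructure.
Variables (W : Type) (R : relation W) (R_order : order W R) (w : W).
Variables (X : set nat) (X_sent : X `<=` SENT L).

(** The least persistent interpretation containing [X] at [w]. *)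
Let I (v : W) : set nat := [set x | R w v /\ X x].

Let I_sent v : I v `<=` SENT L.
Proof. by move=> x [_ /X_sent]. Qed.

Let I_persistent u v : R u v -> I u `<=` I v.
Proof.
by case: R_order => _ R_trans _ uv x [wu Xx]; split=> //; exact: R_trans uv.
Qed.

Definition upset_structure : structure L :=
  Structure R_order I_sent I_persistent.

Lemma interp_upset_structure : interp (w : world upset_structure) = X.
Proof.
case: R_order => R_refl _ _; rewrite eqEsubset.
by split=> [x [] | x Xx] //; split=> //; exact: R_refl.
Qed.

End UpsetStructure.

Lemma Jsvi_sent X : Jsvi L X `<=` SENT L.
Proof. by move=> _ [A [sA -> _]]; exists A. Qed.

Lemma Jsvi_monotone X Y : X `<=` SENT L -> X `<=` Y -> Jsvi L X `<=` Jsvi L Y.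
Proof.
move=> XS XY _ [A [sA -> AX]]; exists A; split=> // M w wY M' f [f_inj f_le f_I].
pose M0 := upset_structure _ _ (@wle_order L M) w _ XS.
apply: (AX M0 w (interp_upset_structure _ _ _ _ _ _) M' f).
(* [f] embeds [M0] too: above [w], [X] lies in [Y = interp w], which persists to [v] and passes
   along [f]. *)
split=> // v x [wv Xx]; apply/f_I/(interp_persistent wv).
by rewrite wY; exact: XY.
Qed.

Lemma code_Bot_notin_Jsvi X : X `<=` SENT L -> ~ Jsvi L X (code (Bot L)).
Proof.
move=> XS [A [_ /code_inj <- BotX]].
have eq_order : order unit eq by split=> // x y z -> ->.
pose M := upset_structure _ _ eq_order tt _ XS.
(* Forcing [Bot] at [tt] unfolds to [False]. *)
exact: (BotX M tt (interp_upset_structure _ _ _ _ _ _) M id (embedding_id M)).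
Qed.

Lemma Jsvi_neq_SENT X : X `<=` SENT L -> Jsvi L X <> SENT L.
Proof.
by move=> XS JX; apply: (code_Bot_notin_Jsvi X XS); rewrite JX; exists (Bot L).
Qed.

End Supervaluation.

Theorem proposition6 (L : pr_signature) :
  ((forall X Y : set nat, X `<=` SENT L -> Y `<=` SENT L ->
      X `<=` Y -> Jsvi L X `<=` Jsvi L Y) /\
   (exists X : set nat, X `<=` SENT L /\ Jsvi L X = X)) /\
  ((forall (M : structure L) (w : world M),
      exists (M' : structure L) (f : world M -> world M'), embedding f) /\
   (exists X : set nat, [/\ X `<=` SENT L, X = Jsvi L X & X <> SENT L])).
Proof.
have mono X Y : X `<=` SENT L -> Y `<=` SENT L ->
    X `<=` Y -> Jsvi L X `<=` Jsvi L Y by move=> XS _; exact: Jsvi_monotone.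
have [X [XS JX]] := fixpoint_of_monotone _ _ _ (Jsvi_sent L) mono.
split; split=> //; first by exists X.
  by move=> M _; exists M, id; exact: embedding_id.
(* No fixed point is degenerate, so the one already found serves. *)
by exists X; split=> //; rewrite -JX; exact: Jsvi_neq_SENT.
Qed.
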